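(* Fix $r\ge1$ and points $s_1,\dots,s_r\in X_2$. There exists a $\mu$-null set $N(s_1,\dots,s_r)\subset\Omega$ with the following property: for every $\omega\in\Omega\setminus N(s_1,\dots,s_r)$ and every $k\in\{1,\dots,m\}$, $$M_\infty(s_i,s_j;\iota_k(\omega))=m\,M_\infty(\varphi_k(s_i),\varphi_k(s_j);\omega)\qquad(1\le i,j\le r).$$ In particular, for every $\omega\in\Omega\setminus N(s_1,\dots,s_r)$ and every $i,j\in\{1,\dots,r\}$, $$M_\infty(s_i,s_j;\omega)=m\,M_\infty(\varphi_{\omega_1}(s_i),\varphi_{\omega_1}(s_j);\sigma(\omega)).$$
   Context: Let $X$ be a set, $m\ge1$ an integer, and $\varphi_1,\dots,\varphi_m:X\to X$ maps. A kernel $J:Y\times Y\to\mathbb{C}$ is positive definite if $\sum_{\alpha,\beta}\overline{c_\alpha}c_\beta J(s_\alpha,s_\beta)\ge0$ for all finite families $(c_\alpha,s_\alpha)\in\mathbb{C}\times Y$; $J_1\le J_2$ means that $J_2-J_1$ is positive definite. The pullback operator is $(LJ)(s,t):=\sum_{i=1}^m J(\varphi_i(s),\varphi_i(t))$. Fix a positive definite kernel $K$ on $X$ with $LK\ge K$. Set $K_0:=K$, $K_{n+1}:=LK_n$, $u_n(s):=K_n(s,s)$ (nondecreasing in $n$), $u_\infty(s):=\lim_nu_n(s)\in[0,\infty]$, $X_{\mathrm{fin}}:=\{s\in X:u_\infty(s)<\infty\}$. Each $\varphi_i$ maps $X_{\mathrm{fin}}$ into itself. For $s,t\in X_{\mathrm{fin}}$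 the limit $K_\infty(s,t):=\lim_nK_n(s,t)$ exists; $K_\infty$ is positive definite on $X_{\mathrm{fin}}$ and $LK_\infty=K_\infty$ there; $K_\infty(s,s)=u_\infty(s)$. Words: $W_n:=\{1,\dots,m\}^n$, $W_0=\{\emptyset\}$; for $w=i_1\cdots i_n\in W_n$, $\varphi_w:=\varphi_{i_n}\circ\cdots\circ\varphi_{i_1}$ ($\varphi_\emptyset=\mathrm{id}$). $\Omega:=\{1,\dots,m\}^{\mathbb{N}}$ with product $\sigma$-algebra and product probability measure $\mu$ making the coordinates independent and uniform on $\{1,\dots,m\}$. For $\omega=\omega_1\omega_2\cdots\in\Omega$, $\omega|n:=\omega_1\cdots\omega_n\in W_n$ ($\omega|0=\emptyset$). For $s,t\in X_{\mathrm{fin}}$, $M_n(s,t;\omega):=m^nK_\infty(\varphi_{\omega|n}(s),\varphi_{\omega|n}(t))$. For $s\in X_{\mathrm{fin}}$ let $B(s):=\sup_{n\ge0}\{m^n\sum_{w\in W_n}u_\infty(\varphi_w(s))^2\}\in[0,\infty]$, and $X_2:=\{s\in X_{\mathrm{fin}}:B(s)<\infty\}$; each $\varphi_k$ maps $X_2$ into itself. For $s,t\in X_2$, $M_n(s,t;\cdot)$ converges in $L^2(\Omega,\mu)$ and $\mu$-almost surely; $M_\infty(s,t;\cdot)\in L^2(\Omega,\mu)$ denotes (a fixed measurable version of) the limit. $\sigma:\Omega\to\Omega$ is the left shift $\sigma(\omega_1\omega_2\cdots)=\omega_2\omega_3\cdots$, and $\iota_i:\Omega\to\Omega$, $\iota_i(\omega)=i\omega$,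 is the prefix map. *)

(* Defs.v *)
(* The complex numbers are R[i] over an arbitrary R : realType. *)
From HB Require Import structures.
From mathcomp Require Import all_boot all_order all_algebra.
From mathcomp Require Import all_classical all_reals all_analysis.
From mathcomp Require Import complex.

Set Implicit Arguments.
Unset Strict Implicit.
Unset Printing Implicit Defensive.

Import Order.TTheory GRing.Theory Num.Theory.
Import numFieldNormedType.Exports.

Local Open Scope classical_set_scope.
Local Open Scope ring_scope.

Section Kernels.
Variables (R : realType) (X : Type).

(* On R[i], 0 <= z means that z is real and nonnegative. *)
Definition posdef (J : X -> X -> R[i]) : Prop :=
  forall (n : nat) (c : 'I_n -> R[i]) (s : 'I_n -> X),
    0 <= \sum_(a < n) \sum_(b < n) (c a)^* * c b * J (s a) (s b).

Definition kernel_le (J1 J2 : X -> X -> R[i]) : Prop :=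
  posdef (fun s t => J2 s t - J1 s t).

Variables (m : nat) (phi : 'I_m -> X -> X).

Definition pullback (J : X -> X -> R[i]) : X -> X -> R[i] :=
  fun s t => \sum_(i < m) J (phi i s) (phi i t).

(* The first letter of the word acts first. *)
Definition phi_word (n : nat) (w : n.-tuple 'I_m) (s : X) : X :=
  foldl (fun x i => phi i x) s w.

Variable K : X -> X -> R[i].

Definition Kn (n : nat) : X -> X -> R[i] := iter n pullback K.

Definition un (n : nat) (s : X) : R := complex.Re (Kn n s s).

Definition uinfty (s : X) : \bar R := limn (fun n => (un n s)%:E).

Definition Xfin : set X := [set s | (uinfty s < +oo)%E].

(* R[i]^o carries the usual topology of the complex plane; the limit is only
   meaningful for s, t in Xfin, elsewhere it may be a default value. *)
Definition Kinfty (s t : X) : R[i] := limn (fun n => Kn n s t : R[i]^o).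

Definition Bsup (s : X) : \bar R :=
  ereal_sup [set ((m ^ n)%:R%:E *
                  \sum_(w : n.-tuple 'I_m) (uinfty (phi_word w s)) ^+ 2)%E
            | n in [set: nat]].

Definition X2 : set X := [set s | Xfin s /\ (Bsup s < +oo)%E].

End Kernels.

Section SequenceSpace.
Variables (m : nat) (m_gt0 : (0 < m)%N).

(* The positivity proof is a parameter of the type because measurable types
   are pointed, hence nonempty. *)
Definition letters (_ : (0 < m)%N) : Type := nat -> 'I_m.

HB.instance Definition _ := Choice.copy (letters m_gt0) (nat -> 'I_m).
HB.instance Definition _ := isPointed.Build (letters m_gt0)
  (fun _ => Ordinal m_gt0).

Definition coord_events : set (set (letters m_gt0)) :=
  [set E | exists (n : nat) (A : set 'I_m), E = [set omega | A (omega n)]].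

(* Sequences omega_1 omega_2 ..., with omega_(n+1) stored at index n, equipped
   with the product sigma-algebra of the discrete one on 'I_m. *)
Definition Omega : Type := g_sigma_algebraType coord_events.

Definition omega_prefix (omega : Omega) (n : nat) : n.-tuple 'I_m :=
  [tuple omega (i : nat) | i < n].

Definition left_shift (omega : Omega) : Omega := fun n => omega n.+1.

Definition prepend (k : 'I_m) (omega : Omega) : Omega :=
  fun n => if n is n'.+1 then omega n' else k.

Variables (R : realType) (mu : probability Omega R).

Definition uniform_coords : Prop :=
  forall (n : nat) (i : 'I_m),
    mu [set omega | omega n = i] = (m%:R^-1)%:E.

Definition independent_coords : Prop :=
  forall (J : seq nat) (A : nat -> set 'I_m), uniq J ->
    mu [set omega | forall n, n \in J -> A n (omega n)] =
    (\prod_(n <- J) mu [set omega | A n (omega n)])%E.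

(* Uniquely determines mu (pi-lambda theorem). *)
Definition uniform_product_measure : Prop :=
  uniform_coords /\ independent_coords.

(* Borel measurability for the identification of R[i] with R * R. *)
Definition measurable_complex (f : Omega -> R[i]) : Prop :=
  measurable_fun [set: Omega] (fun omega => complex.Re (f omega)) /\
  measurable_fun [set: Omega] (fun omega => complex.Im (f omega)).

Definition L2norm (f : Omega -> R[i]) : \bar R :=
  Lnorm mu 2%:E (fun omega => (ComplexField.Normc.normc (f omega))%:E).

Definition in_L2 (f : Omega -> R[i]) : Prop :=
  measurable_complex f /\ (L2norm f < +oo)%E.

Variables (X : Type) (phi : 'I_m -> X -> X) (K : X -> X -> R[i]).

Definition Mn (n : nat) (s t : X) (omega : Omega) : R[i] :=
  (m ^ n)%:R * Kinfty phi K (phi_word phi (omega_prefix omega n) s)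
                            (phi_word phi (omega_prefix omega n) t).

(* Minf s t is a version of the L^2 and almost sure limit of Mn s t, for all
   s, t in X2; its values elsewhere are irrelevant. *)
Definition is_Minfty (Minf : X -> X -> Omega -> R[i]) : Prop :=
  forall s t : X, X2 phi K s -> X2 phi K t ->
    [/\ in_L2 (Minf s t),
        (fun n => L2norm (fun omega => Mn n s t omega - Minf s t omega))
          @ \oo --> 0%E
      & {ae mu, forall omega,
          (fun n => Mn n s t omega : R[i]^o) @ \oo -->
            (Minf s t omega : R[i]^o)}].

End SequenceSpace.

(* Main.v *)
Require Import Defs.
From HB Require Import structures.
From mathcomp Require Import all_boot all_order all_algebra.
From mathcomp Require Import all_classical all_reals all_analysis.
From mathcomp Require Import complex.

Set Implicit Arguments.
Unset Strict Implicit.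
Unset Printing Implicit Defensive.

Import Order.TTheory GRing.Theory Num.Theory.
Import numFieldNormedType.Exports.

Local Open Scope classical_set_scope.
Local Open Scope ring_scope.

(** The martingale identity behind the theorem is exact for finite [n]: a
    prefix of length [n.+1] of the sequence [k omega] applies [phi k] first and
    then runs through the prefix of length [n] of [omega], so
    [M_(n+1)(s, t; k omega) = m * M_n(phi_k s, phi_k t; omega)] ([Mn_prepend]).
    Letting [n] tend to infinity gives the first identity at every [omega] for
    which [M_n(s, t)] converges to the chosen version at [k omega] and
    [M_n(phi_k s, phi_k t)] converges to its version at [omega].

    Two facts make this hold almost everywhere. First, [phi_k s] and [phi_k t]
    are again in [X2] ([X2_phi]), so almost sure convergence is known there: the
    words of length [n] started at [phi_k s] are words of length [n.+1] started
    at [s]. Second, the exceptional null set at [k omega] has to be pulled back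
    along the prefix map, which is harmless because prefix maps are
    nonsingular ([prepend_null]). That rests on the independence of the first
    letter and the shifted sequence,
    [mu (sigma^-1 B /\ {omega_1 = k}) = mu B / m]
    ([first_letter_indep_shift]): if [A] is null and [B] is its preimage under
    the prefix map, then [sigma^-1 B /\ {omega_1 = k}] is contained in [A].

    The second identity at [omega] is the first one at [sigma omega] with
    [k = omega_1]. Summing the same independence formula over [k] shows that the
    shift preserves [mu] ([left_shift_preserves]), so discarding the preimage
    of the first exceptional set under the shift costs nothing. Finitely many
    pairs of points and letters are involved, so the union of all exceptional
    sets is null. *)

(** * The shift and the prefix maps on the sequence space *)

Section ProductMeasure.
Context {m : nat} {m_gt0 : (0 < m)%N} {R : realType}.
Local Notation Omega := (Omega m_gt0).

Lemma measurable_coord (n : nat) (A : set 'I_m) :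
  measurable [set omega : Omega | A (omega n)].
Proof. by apply: sub_sigma_algebra; exists n, A. Qed.

Lemma measurable_into_Omega (d : measure_display) (T : measurableType d)
    (f : T -> Omega) :
  (forall n (A : set 'I_m), measurable [set x | A (f x n)]) ->
  measurable_fun [set: T] f.
Proof.
move=> mf; apply:
  (@measurability _ _ T Omega setT f (@coord_events m m_gt0)) => //.
by move=> _ [_ [n [A ->]] <-]; rewrite setTI; exact: mf.
Qed.

Lemma measurable_left_shift :
  measurable_fun [set: Omega] (@left_shift m m_gt0).
Proof. by apply: measurable_into_Omega => n A; exact: measurable_coord. Qed.

Lemma measurable_prepend (k : 'I_m) :
  measurable_fun [set: Omega] (@prepend m m_gt0 k).
Proof.
apply: measurable_into_Omega => -[|n] A; last exact: measurable_coord.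
have [Ak|nAk] := pselect (A k).
  by rewrite (_ : [set _ | _] = setT)//; apply/seteqP; split.
by rewrite (_ : [set _ | _] = set0)//; apply/seteqP; split.
Qed.

(** The coordinates are listed as [iota 0 N] to match the form in which the
    independence of the coordinates is given. *)
Definition cylinder (N : nat) (A : nat -> set 'I_m) : set Omega :=
  [set omega | forall n, n \in iota 0 N -> A n (omega n)].

Definition cylinders : set (set Omega) :=
  [set E | exists N A, E = cylinder N A].

Lemma measurable_cylinder N A : measurable (cylinder N A).
Proof.
rewrite (_ : cylinder N A =
    \bigcap_(n in [set` iota 0 N]) [set omega : Omega | A n (omega n)])//.
apply: fin_bigcap_measurable => // n _; exact: measurable_coord.
Qed.

Lemma cylinders_setI : setI_closed cylinders.
Proof.
move=> _ _ [N1 [A1 ->]] [N2 [A2 ->]].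
(* Each family imposes nothing on coordinates beyond its own range. *)
exists (maxn N1 N2), (fun n => [set i | ((n < N1)%N -> A1 n i) /\
                                        ((n < N2)%N -> A2 n i)]).
apply/seteqP; split=> omega /=.
  case=> H1 H2 n _; split=> nN; [apply: H1|apply: H2];
    by rewrite mem_iota.
move=> H; split=> n; rewrite mem_iota /= add0n => nN.
  by have [|+ _] := H n; [rewrite mem_iota add0n leq_max nN|apply].
by have [|_ +] := H n; [rewrite mem_iota add0n leq_max nN orbT|apply].
Qed.

Lemma measurable_cylindersE : @measurable _ Omega = <<s cylinders >>.
Proof.
apply/seteqP; split.
  apply: smallest_sub; first exact: smallest_sigma_algebra.
  move=> _ [n [A ->]]; apply: sub_sigma_algebra.
  exists n.+1, (fun k => [set i | k = n -> A i]).
  apply/seteqP; split=> omega /=.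
    by move=> An k _ ->.
  by move=> /(_ n); rewrite mem_iota/= leqnn; apply.
apply: smallest_sub; first exact: sigma_algebra_measurable.
by move=> _ [N [A ->]]; exact: measurable_cylinder.
Qed.

Section Uniform.
Variables (mu : probability Omega R) (mu_prod : uniform_product_measure mu).
Local Open Scope ereal_scope.

(** Both sides are [#|A| / m]; uniformity is only given for single letters, so
    [A] is split into its elements. *)
Lemma coord_stationary n (A : set 'I_m) :
  mu [set omega | A (omega n.+1)] = mu [set omega | A (omega n)].
Proof.
have coordE l : mu [set omega | A (omega l)] = \sum_(i \in A) (m%:R^-1 : R)%:E.
  rewrite (_ : [set _ | _] =
      \bigcup_(i in A) [set omega | omega l = i]); last first.
    by apply/seteqP; split=> omega /= => [Al|[i Ai ->]//]; exists (omega l).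
  rewrite measure_fin_bigcup //.
  - by apply: eq_fsbigr => i _; exact: mu_prod.1.
  - exact: finite_finset.
  - apply/trivIsetP => i j _ _ /eqP ij.
    by apply/seteqP; split=> // omega /= [-> /ij].
  - by move=> i _; exact: (measurable_coord l [set i]).
by rewrite !coordE.
Qed.

Lemma mu_cylinder N A :
  mu (cylinder N A) = \prod_(n <- iota 0 N) mu [set omega | A n (omega n)].
Proof. exact: mu_prod.2 (iota_uniq 0 N). Qed.

(** Both sides are finite measures in [B], so it suffices to compare them on
    cylinders. The left side of a cylinder is the cylinder with one more
    constraint [omega 0 = k] in front, and its measure factors by independence;
    the remaining factors do not see the shift since the coordinates are
    identically distributed. *)
Lemma first_letter_indep_shift (k : 'I_m) (B : set Omega) : measurable B ->
  mu (@left_shift m m_gt0 @^-1` B `&` [set omega | omega 0%N = k]) =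
  (m%:R^-1)%:E * mu B.
Proof.
move=> mB.
have mk : measurable [set omega : Omega | omega 0%N = k].
  exact: (measurable_coord 0 [set k]).
have m_inv_ge0 : (0 <= m%:R^-1 :> R)%R by [].
(* The measure structure of a pushforward depends on the measurability of the
   map, so [nu1_of] is a function of that proof. *)
pose nu1_of : {measure set Omega -> \bar R} :=
  @pushforward _ _ Omega Omega R (mrestr mu mk) (@left_shift m m_gt0).
pose nu1 := nu1_of measurable_left_shift.
pose nu2 : {measure set Omega -> \bar R} := mscale (NngNum m_inv_ge0) mu.
suff nuE C : cylinders C -> nu1 C = nu2 C.
  apply: (measure_unique cylinders (fun=> setT) measurable_cylindersE
    cylinders_setI _ _ nu1 nu2 nuE) => //.
  - move=> _; exists 0%N, (fun=> setT); exact/seteqP.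
  - by rewrite bigcup_const //; exists 0%N.
  - move=> _; rewrite /nu1 /= /pushforward /mrestr preimage_setT setTI.
    by rewrite mu_prod.1 ltry.
move=> [N [A ->]]; rewrite /nu1 /nu2 /= /pushforward /mrestr /mscale /=.
rewrite (_ : _ `&` _ =
    cylinder N.+1 (fun n => if n is n'.+1 then A n' else [set k])); last first.
  apply/seteqP; split=> omega /=.
    case=> H w0 [//|n]; rewrite in_cons mem_iota /= => nN.
    by apply: H; rewrite mem_iota.
  move=> H; split=> [n|]; last by apply: (H 0%N); rewrite mem_head.
  by rewrite mem_iota /= => nN; apply: (H n.+1); rewrite in_cons mem_iota.
rewrite !mu_cylinder /= big_cons (iotaDl 1 0) mu_prod.1; congr (_ * _).
rewrite [LHS]big_map.
by apply: eq_bigr => n _; exact: (coord_stationary n (A n)).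
Qed.

Lemma left_shift_preserves (B : set Omega) : measurable B ->
  mu (@left_shift m m_gt0 @^-1` B) = mu B.
Proof.
move=> mB.
have mSB : measurable (@left_shift m m_gt0 @^-1` B).
  by rewrite -[X in measurable X]setTI; exact: measurable_left_shift.
rewrite [X in mu X](_ : _ @^-1` B =
    \bigcup_(k in [set` index_enum 'I_m]) (@left_shift m m_gt0 @^-1` B `&`
      [set omega | omega 0%N = k])); last first.
  apply/seteqP; split=> omega /= => [Bo|[k _ []//]].
  by exists (omega 0%N) => //=; rewrite mem_index_enum.
rewrite measure_fin_bigcup.
- rewrite (eq_fsbigr (fun=> (m%:R^-1)%:E * mu B)); last first.
    by move=> k _; exact: first_letter_indep_shift.
  rewrite -fsbig_seq ?index_enum_uniq// -ge0_sume_distrl//.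
  rewrite sumEFin sumr_const card_ord -[X in X%:E]mulr_natl mulfV ?mul1e//.
  by rewrite pnatr_eq0 -lt0n.
- exact: finite_finpred.
- apply/trivIsetP => i j _ _ /eqP ij.
  by apply/seteqP; split=> // omega /= [[_ ->] [_ /ij]].
- move=> k _; apply: measurableI => //; exact: (measurable_coord 0 [set k]).
Qed.


(** The preimage [B] of [A] has measure [m * mu (sigma^-1 B /\ {omega_1 = k})],
    and that intersection lies in the null set [A]. *)
Lemma prepend_null (k : 'I_m) (A : set Omega) : measurable A -> mu A = 0 ->
  mu (@prepend m m_gt0 k @^-1` A) = 0.
Proof.
move=> mA A0.
have mkA : measurable (@prepend m m_gt0 k @^-1` A).
  by rewrite -[X in measurable X]setTI; exact: measurable_prepend.
have mk : measurable [set omega : Omega | omega 0%N = k].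
  exact: (measurable_coord 0 [set k]).
have := first_letter_indep_shift k mkA.
rewrite (subset_measure0 _ mA _ A0).
- move/esym/eqP; rewrite mule_eq0 => /orP[|/eqP//].
  by rewrite eqe invr_eq0 pnatr_eq0 eqn0Ngt m_gt0.
- apply: measurableI => //.
  by rewrite -[X in measurable X]setTI; exact: measurable_left_shift.
- (* A sequence starting with [k] is the prefix map applied to its shift. *)
  by move=> omega [/= + w0]; congr A; apply/funext => -[].
Qed.

Lemma ae_comp (f : Omega -> Omega) (P : Omega -> Prop) :
  measurable_fun [set: Omega] f ->
  (forall A, measurable A -> mu A = 0 -> mu (f @^-1` A) = 0) ->
  {ae mu, forall omega, P omega} -> {ae mu, forall omega, P (f omega)}.
Proof.
move=> mf f_null [A [mA A0 PA]]; exists (f @^-1` A); split.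
- by rewrite -[X in measurable X]setTI; exact: mf.
- exact: f_null.
- by move=> omega; exact: PA.
Qed.

End Uniform.
End ProductMeasure.

(** * Prepending a letter and passing to the limit *)

Lemma phi_word_prepend (X : Type) (m : nat) (m_gt0 : (0 < m)%N)
    (phi : 'I_m -> X -> X) (k : 'I_m) (omega : Omega m_gt0) (n : nat) (x : X) :
  phi_word phi (omega_prefix (prepend k omega) n.+1) x =
  phi_word phi (omega_prefix omega n) (phi k x).
Proof.
rewrite /phi_word
  (_ : omega_prefix _ _ = [tuple of k :: omega_prefix omega n]) //.
apply: eq_from_tnth => i; rewrite tnth_mktuple.
by case: (unliftP ord0 i) => [j|] ->; rewrite ?tnthS ?tnth_mktuple.
Qed.

Lemma Mn_prepend (R : realType) (X : Type) (m : nat) (m_gt0 : (0 < m)%N)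
    (phi : 'I_m -> X -> X) (K : X -> X -> R[i]) (k : 'I_m)
    (omega : Omega m_gt0) (n : nat) (s t : X) :
  Mn phi K n.+1 s t (prepend k omega) =
  m%:R * Mn phi K n (phi k s) (phi k t) omega.
Proof. by rewrite /Mn !phi_word_prepend expnS natrM mulrA. Qed.

Lemma lim_succ_scale (R : realType) (u v : nat -> R[i]) (c x y : R[i]) :
  (forall n, u n.+1 = c * v n) ->
  (fun n => u n : R[i]^o) @ \oo --> (x : R[i]^o) ->
  (fun n => v n : R[i]^o) @ \oo --> (y : R[i]^o) ->
  x = c * y.
Proof.
move=> uv; rewrite -(@cvg_shiftS R[i]^o u) (funext uv) => cvx cvy.
have cvcy : (fun n => c * v n : R[i]^o) @ \oo --> (c * y : R[i]^o).
  exact: (@cvgMl_tmp R[i]) cvy.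
exact: (@cvg_unique R[i]^o (@norm_hausdorff _ _) _ _ x (c * y) cvx cvcy).
Qed.

(** * Stability of [X2] under the maps *)

Lemma posdef_diag (R : realType) (X : Type) (J : X -> X -> R[i]) (s : X) :
  posdef J -> 0 <= complex.Re (J s s).
Proof.
move=> /(_ 1%N (fun=> 1) (fun=> s)).
by rewrite !big_ord1 conjC1 !mul1r lecE => /andP[].
Qed.

Lemma posdef_pullback (R : realType) (X : Type) (m : nat)
    (phi : 'I_m -> X -> X) (J : X -> X -> R[i]) :
  posdef J -> posdef (pullback phi J).
Proof.
move=> J_pd n c s.
rewrite [leRHS](_ : _ = \sum_(i < m) \sum_(a < n) \sum_(b < n)
    (c a)^* * c b * J (phi i (s a)) (phi i (s b))); last first.
  rewrite [RHS]exchange_big; apply: eq_bigr => a _.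
  rewrite [RHS]exchange_big; apply: eq_bigr => b _.
  by rewrite mulr_sumr.
by apply: sumr_ge0 => i _; exact: J_pd.
Qed.

Lemma kernel_le_pullback (R : realType) (X : Type) (m : nat)
    (phi : 'I_m -> X -> X) (J1 J2 : X -> X -> R[i]) :
  kernel_le J1 J2 -> kernel_le (pullback phi J1) (pullback phi J2).
Proof.
move=> /(posdef_pullback phi); rewrite /kernel_le; congr posdef.
by apply/funext => s; apply/funext => t; rewrite -sumrB.
Qed.

Section Diagonal.
Context {R : realType} {X : Type} {m : nat} (phi : 'I_m -> X -> X)
  (K : X -> X -> R[i]).
Hypotheses (K_pd : posdef K) (K_le : kernel_le K (pullback phi K)).

Lemma un_ge0 n s : 0 <= un phi K n s.
Proof.
apply: posdef_diag; elim: n => [//|n IHn].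
exact: posdef_pullback.
Qed.

Lemma un_succ n s : un phi K n s <= un phi K n.+1 s.
Proof.
have : kernel_le (Kn phi K n) (Kn phi K n.+1).
  by elim: n => [//|n IHn]; exact: kernel_le_pullback.
by move=> /(@posdef_diag _ _ _ s); rewrite raddfB subr_ge0.
Qed.

Lemma un_phi n k s : un phi K n (phi k s) <= un phi K n.+1 s.
Proof.
rewrite {2}/un /Kn iterS /pullback raddf_sum (bigD1 k)//= lerDl.
by apply: sumr_ge0 => i _; exact: un_ge0.
Qed.

(** The condition [K <= pullback phi K] is inherited by all iterates, so the
    diagonal values increase and their limit is a supremum. *)
Lemma uinfty_sup s :
  uinfty phi K s = ereal_sup (range (fun n => (un phi K n s)%:E)).
Proof.
apply/cvg_lim => //; apply: ereal_nondecreasing_cvgn.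
by apply/nondecreasing_seqP => n; rewrite lee_fin un_succ.
Qed.

Lemma uinfty_ge0 s : (0 <= uinfty phi K s)%E.
Proof.
rewrite uinfty_sup; apply: (@le_trans _ _ (un phi K 0 s)%:E).
  by rewrite lee_fin un_ge0.
by apply: ereal_sup_ubound; exists 0%N.
Qed.

Lemma uinfty_phi k s : (uinfty phi K (phi k s) <= uinfty phi K s)%E.
Proof.
rewrite !uinfty_sup; apply: ge_ereal_sup => _ [n _ <-].
apply: (@le_trans _ _ (un phi K n.+1 s)%:E); first by rewrite lee_fin un_phi.
by apply: ereal_sup_ubound; exists n.+1.
Qed.

(** The words of length [n] applied to [phi k s] are the words of length [n.+1]
    starting with [k] applied to [s], so the sum at level [n] for [phi k s] is
    part of the sum at level [n.+1] for [s]. *)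
Lemma Bsup_phi k s : (Bsup phi K (phi k s) <= Bsup phi K s)%E.
Proof.
apply: ge_ereal_sup => _ [n _ <-].
have m_gt0 : (0 < m)%N by case: m k => [[]|].
pose F (w : n.+1.-tuple 'I_m) := ((uinfty phi K (phi_word phi w s)) ^+ 2)%E.
have F_ge0 w : (0 <= F w)%E by rewrite /F expe2 mule_ge0 ?uinfty_ge0.
apply: (@le_trans _ _ ((m ^ n.+1)%:R%:E * \sum_(w : n.+1.-tuple 'I_m) F w)%E);
  last by apply: ereal_sup_ubound; exists n.+1.
apply: lee_pmul.
- by rewrite lee_fin.
- by apply: sume_ge0 => w _; rewrite expe2 mule_ge0 ?uinfty_ge0.
- by rewrite lee_fin ler_nat leq_pexp2l.
apply: (@le_trans _ _ (\sum_(w : n.+1.-tuple 'I_m | thead w == k) F w)%E).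
  rewrite (reindex_onto (fun w : n.-tuple 'I_m => [tuple of k :: w])
                        (fun w => [tuple of behead w])) /=; last first.
    by move=> w /eqP <-; rewrite -tuple_eta.
  rewrite le_eqVlt; apply/orP; left; apply/eqP; apply: eq_big => // w.
  by rewrite theadE eqxx; apply/esym/eqP/val_inj.
rewrite big_mkcond /=; apply: lee_sum => w _.
by case: ifP.
Qed.

Lemma X2_phi k s : X2 phi K s -> X2 phi K (phi k s).
Proof.
by case=> ufin Bfin; split; [exact: le_lt_trans (uinfty_phi k s) ufin
                            |exact: le_lt_trans (Bsup_phi k s) Bfin].
Qed.

End Diagonal.

(** * The cocycle identity *)

Theorem theorem6p2 (R : realType) (X : Type) (m : nat) (m_gt0 : (0 < m)%N)
    (phi : 'I_m -> X -> X) (K : X -> X -> R[i])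
    (K_posdef : posdef K) (K_le : kernel_le K (pullback phi K))
    (mu : probability (Omega m_gt0) R) (mu_prod : uniform_product_measure mu)
    (Minf : X -> X -> Omega m_gt0 -> R[i])
    (Minf_lim : is_Minfty mu phi K Minf)
    (r : nat) (r_gt0 : (0 < r)%N)
    (s : 'I_r -> X) (s_X2 : forall i : 'I_r, X2 phi K (s i)) :
  exists N : set (Omega m_gt0),
    [/\ measurable N,
        mu N = 0%E,
        (forall omega : Omega m_gt0, ~ N omega ->
          forall (k : 'I_m) (i j : 'I_r),
            Minf (s i) (s j) (prepend k omega) =
            m%:R * Minf (phi k (s i)) (phi k (s j)) omega)
      & (forall omega : Omega m_gt0, ~ N omega ->
          forall i j : 'I_r,
            Minf (s i) (s j) omega =
            m%:R * Minf (phi (omega 0%N) (s i)) (phi (omega 0%N) (s j))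
                     (left_shift omega))].
Proof.
pose P omega := forall (k : 'I_m) (i j : 'I_r),
  Minf (s i) (s j) (prepend k omega) =
  m%:R * Minf (phi k (s i)) (phi k (s j)) omega.
have P_ae : {ae mu, forall omega, P omega}.
  apply: filter_forall => k; apply: filter_forall => i.
  apply: filter_forall => j.
  have [_ _ cvg_word] := Minf_lim _ _ (s_X2 i) (s_X2 j).
  have [_ _ cvg_tail] := Minf_lim _ _
    (X2_phi K_posdef K_le k (s_X2 i)) (X2_phi K_posdef K_le k (s_X2 j)).
  have {}cvg_word := ae_comp (measurable_prepend k)
    (prepend_null mu_prod k) cvg_word.
  apply: filterS2 cvg_word cvg_tail => omega.
  by apply: lim_succ_scale => n; exact: Mn_prepend.
have P_shift_ae : {ae mu, forall omega, P (left_shift omega)}.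
  apply: ae_comp measurable_left_shift _ P_ae => A mA A0.
  by rewrite left_shift_preserves.
have [N [mN N0 NP]] := filterI P_ae P_shift_ae.
exists N; split=> // omega nN; have [Pw PSw] : P omega /\ P (left_shift omega).
- by apply: contrapT => nP; apply/nN/NP.
- exact: Pw.
- by apply: contrapT => nP; apply/nN/NP.
- move=> i j; rewrite -PSw; congr (Minf _ _ _).
  by apply/funext => -[|n].
Qed.
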